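(* Let $G$ be a finite directed multigraph and let $q,s:V(G)\to\mathbb{Z}_{\ge 0}$ be a quota and a start portfolio, with $q(v)>0$ for all $v\in V(G)$. Let $\{x_e\}_{e\in E(G)}$ be the edge inventory of any quota forest in $G$ achieving quotas $q$ with start portfolio $s$. Then the following constraints hold: (edge) for each edge $e\in E(G)$, $0\le x_e\le q(i(e))$; (node) for each vertex $v\in V(G)$, $\sum_{e:\,t(e)=v}x_e=q(v)-s(v)$; (subset) for each subset $S\subset V(G)$ with $|S|\ge 1$, $\sum_{e\in E(G[S])}x_e\le \left(\sum_{v\in S}q(v)\right)-1$, where $G[S]$ is the subgraph of $G$ induced by $S$. Conversely, if $(G,q,s)$ is achievable and $\{x_e\}_{e\in E(G)}$ are integers satisfying the constraints (edge), (node) and (subset), then there exists a quota forest in $G$ achieving quotas $q$ with start portfolio $s$ whose edge inventory is $\{x_e\}$.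
   Context: A directed multigraph $G=(V,E,i,t)$ has a vertex set $V=V(G)$, an edge set $E=E(G)$, and maps $i,t:E\to V$ giving the initial and terminal vertex of each edge; loops and multiple (distinguishable) edges are allowed. A map $f:T\to G$ of multigraphs sends vertices to vertices and edges to edges and respects $i$ and $t$. It is an immersion if for every vertex $v$ it is injective on the set of outgoing edges of $v$. A quota tree with root $*\in V(G)$ and quota $q$ is an immersion $f:T\to G$, where $T$ is a finite rooted tree with all edges directed away from its root, such that the root of $T$ maps to $*$ and $|f^{-1}(v)|=q(v)$ for all $v\in V(G)$. A quota forest with start portfolio $s$ is a disjoint union $F$ of quota trees $\{T_{v,k}\mid v\in V(G),\ 1\le k\le s(v)\}$ such that the root of $T_{v,k}$ maps to $v$; the quota it achieves is the sum of the quotas of its component trees. The immersions of the components combine to an immersion $f:F\to G$, and the edge inventory of the forest is $x_e=|f^{-1}(e)|$ for $e\in E(G)$. $(G,q,s)$ is achievable if quota search in $G$ with start portfolio $s$ can achieve the quotas $q$, i.e. if there is a quota forest achieving quota $q$ with some start portfolio $s'$ satisfying $s'(v)\le s(v)$ for all $v$. *)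

(* Defs.v *)
From mathcomp Require Import all_boot all_order all_algebra.

Set Implicit Arguments.
Unset Strict Implicit.
Unset Printing Implicit Defensive.

Record multigraph := Multigraph {
  vert :> finType;
  edge : finType;
  ini : edge -> vert;
  ter : edge -> vert
}.

Record gmap (T G : multigraph) := GMap {
  vmap :> T -> G;
  emap : edge T -> edge G;
  gmap_ini : forall a, ini (emap a) = vmap (ini a);
  gmap_ter : forall a, ter (emap a) = vmap (ter a)
}.

Definition immersion (T G : multigraph) (f : gmap T G) : Prop :=
  forall v : T, {in [pred a | ini a == v] &, injective (emap f)}.

Definition vfiber (T G : multigraph) (f : gmap T G) (v : G) : {set T} :=
  [set u | f u == v].

Definition efiber (T G : multigraph) (f : gmap T G) (e : edge G) :
    {set edge T} :=
  [set a | emap f a == e].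

Fixpoint diwalk (T : multigraph) (u w : T) (p : seq (edge T)) : bool :=
  if p is a :: p' then (ini a == u) && diwalk (ter a) w p' else u == w.

(* A rooted tree with all edges directed away from its root r: every vertex,
   r included, is the end of exactly one directed walk starting at r.  The
   case of r itself (only the empty walk) excludes loops and edges into r. *)
Definition out_tree (T : multigraph) (r : T) : Prop :=
  forall u : T, exists! p : seq (edge T), diwalk r u p.

Record quota_tree (G : multigraph) (root : G) := QuotaTree {
  tree :> multigraph;
  tree_root : tree;
  tree_map : gmap tree G;
  tree_out : out_tree tree_root;
  tree_immersion : immersion tree_map;
  tree_map_root : tree_map tree_root = root
}.

Definition tree_quota (G : multigraph) (root : G) (T : quota_tree root)
    (v : G) : nat :=
  #|vfiber (tree_map T) v|.

(* The trees T_{v,k} are indexed by k : 'I_(s v), i.e. from 0 to s v - 1. *)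
Definition quota_forest (G : multigraph) (s : G -> nat) : Type :=
  forall v : G, 'I_(s v) -> quota_tree v.

Section Forest.

Variables (G : multigraph) (s : G -> nat) (F : quota_forest s).

Definition tree_index : finType := {v : G & 'I_(s v)}.

Definition component (j : tree_index) : quota_tree (tag j) := @F (tag j) (tagged j).

Definition forest_graph : multigraph :=
  @Multigraph {j : tree_index & vert (component j)}
              {j : tree_index & edge (component j)}
    (fun a => Tagged (fun j => vert (component j)) (ini (tagged a)))
    (fun a => Tagged (fun j => vert (component j)) (ter (tagged a))).

Definition forest_vmap (u : forest_graph) : G :=
  tree_map (component (tag u)) (tagged u).

Definition forest_emap (a : edge forest_graph) : edge G :=
  emap (tree_map (component (tag a))) (tagged a).

Fact forest_map_ini a : ini (forest_emap a) = forest_vmap (ini a).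
Proof. exact: gmap_ini. Qed.

Fact forest_map_ter a : ter (forest_emap a) = forest_vmap (ter a).
Proof. exact: gmap_ter. Qed.

Definition forest_map : gmap forest_graph G :=
  GMap forest_map_ini forest_map_ter.

Definition forest_quota (w : G) : nat :=
  \sum_(v : G) \sum_(k < s v) tree_quota (@F v k) w.

Definition edge_inventory (e : edge G) : nat := #|efiber forest_map e|.

Definition achieves (q : G -> nat) : Prop := forall v, forest_quota v = q v.

Lemma forest_immersion : immersion forest_map.
Proof.
move=> v [j a] [j' b]; rewrite !inE => /eqP <- /eqP E.
have jj' : j' = j by exact: (congr1 tag E).
case: _ / (esym jj') b E => b.
move/(congr1 (fun u : {j : tree_index & vert (component j)} =>
  tagged_as (Tagged (fun j => vert (component j)) (ini a)) u)).
rewrite !tagged_asE /= => E ab.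
congr (existT _ j _).
by apply: (@tree_immersion _ _ (component j) (ini a)) => //; rewrite inE ?E.
Qed.

End Forest.

Definition achievable (G : multigraph) (q s : G -> nat) : Prop :=
  exists s' : G -> nat,
    (forall v, s' v <= s v) /\ exists F : quota_forest s', achieves F q.

Definition induced_edges (G : multigraph) (S : {set G}) : {set edge G} :=
  [set e | (ini e \in S) && (ter e \in S)].

Local Open Scope ring_scope.

Definition edge_constraint (G : multigraph) (q : G -> nat)
    (x : edge G -> int) : Prop :=
  forall e, 0 <= x e <= (q (ini e))%:Z.

Definition node_constraint (G : multigraph) (q s : G -> nat)
    (x : edge G -> int) : Prop :=
  forall v, \sum_(e | ter e == v) x e = (q v)%:Z - (s v)%:Z.

Definition subset_constraint (G : multigraph) (q : G -> nat)
    (x : edge G -> int) : Prop :=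
  forall S : {set G}, (1 <= #|S|)%N ->
    \sum_(e in induced_edges S) x e <= (\sum_(v in S) (q v)%:Z) - 1.

(* Main.v *)
Require Import Defs.
From mathcomp Require Import all_boot all_order all_algebra.
From mathcomp Require Import zify.

Set Implicit Arguments.
Unset Strict Implicit.
Unset Printing Implicit Defensive.

(** In an out-tree, sending each edge to its end is a bijection from the edges to
the non-root vertices.  Summed over the components of a forest, this gives the
node constraint.  It also gives the subset constraint: the edges with both ends
over S inject by their ends into the vertices over S (there are some, q being
positive), and a vertex over S whose parent is not over S, or which is a root, is
missed.  The edge constraint is immersion:
edges over e have distinct starts, all over the start of e.

For the converse, immersion lets a vertex of a tree be encoded by the word of
edges of G read on the way from it up to the root, so a quota forest is a finite
prefix-closed set of such words ([word_forest], turned back into a quota forest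
by [realize]).  Let y be the prescribed inventory.  The forest is grown greedily
from the bare roots: as long as some edge e is used fewer than y e times and
some vertex over the start of e has no child along e, add that child.  Since
vertex counts are determined by edge counts ([vcountE]), a forest with inventory
y has quota q, so it suffices that greedy growth never gets stuck before reaching
y ([exists_growable]).

Suppose it is stuck, and call e deficient if it is used fewer than y e times:
every vertex over the start of a deficient edge then has a child along it.  Let Z
be the set of vertices of G not visited so far.

If Z is not empty, it contains no root, so all of q over Z has to come from edges
ending in Z, and by the subset constraint some e with y e > 0 enters Z from
outside.  It is unused because its end is unvisited, hence deficient, although the
vertices over its start, of which there are some, have no child along e: a
contradiction
([vcount0_growable]).

If Z is empty, choose a deficient e such that the largest depth of a vertex over
ter e is minimal.  That largest depth is smaller over ini e, because the deepest
vertex over ini e has a child along e ([depth_ter]).  But ini e has been visited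
no more often than e was used, which is less than y e <= q (ini e), so the node
constraint provides a deficient edge into ini e, against minimality. *)

(** * Counting in out-trees *)

Lemma sum_card_fiber (A B : finType) (f : A -> B) (P : pred B) :
  \sum_(b | P b) #|[set a | f a == b]| = #|[set a | P (f a)]|.
Proof.
rewrite -[RHS]sum1dep_card (partition_big f P) //; apply: eq_bigr => b Pb.
rewrite -sum1dep_card; apply: eq_bigl => a.
by case: eqP => [->|]; rewrite ?Pb ?andbF.
Qed.

Lemma diwalk_rcons (T : multigraph) (u w : T) p a :
  diwalk u w (rcons p a) = diwalk u (ini a) p && (ter a == w).
Proof.
elim: p u => [|b p IHp] u /=; first by rewrite (eq_sym u).
by rewrite IHp andbA.
Qed.

Section OutTree.

Variables (T : multigraph) (r : T).
Hypothesis treeT : out_tree r.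

(** The walks to the starts of a and b, prolonged by a and b, are two walks from
the root to the same vertex. *)
Lemma out_tree_ter_inj : injective (@ter T).
Proof.
move=> a b ab.
have [p [pa _]] := treeT (ini a); have [p' [pb _]] := treeT (ini b).
have [w [_ w_uniq]] := treeT (ter a).
have E : rcons p a = rcons p' b.
  rewrite -(w_uniq (rcons p a)) ?diwalk_rcons ?pa ?eqxx //.
  by rewrite (w_uniq (rcons p' b)) // diwalk_rcons pb ab eqxx.
by case: (rcons_inj E).
Qed.

(** An edge into the root would end a nonempty closed walk, besides the empty
one. *)
Lemma out_tree_ter_root a : ter a != r.
Proof.
apply/eqP => ar; have [p [pa _]] := treeT (ini a).
have [w [_ w_uniq]] := treeT r.
have := w_uniq (rcons p a); rewrite diwalk_rcons pa ar eqxx => /(_ isT) wE.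
by have := w_uniq [::] (eqxx r); rewrite wE; case: p {pa wE}.
Qed.

Lemma out_tree_terP u : reflect (exists a, ter a = u) (u != r).
Proof.
apply: (iffP idP) => [ur | [a <-]]; last exact: out_tree_ter_root.
have [p [pu _]] := treeT u; case/lastP: p pu => [/eqP ru | p a].
  by rewrite ru eqxx in ur.
by rewrite diwalk_rcons => /andP[_ /eqP au]; exists a.
Qed.

(** Going up from any vertex of U towards the root, stop just before first leaving
U, or at the root: the edge into the vertex reached, if any, starts outside U. *)
Lemma out_tree_top (U : {set T}) :
  U != set0 -> exists2 u0, u0 \in U & forall a, ter a = u0 -> ini a \notin U.
Proof.
case/set0Pn=> u uU; have [p [pu _]] := treeT u.
elim/last_ind: p u uU pu => [|p b IHp] u uU.
  move=> /eqP ru; exists u => // a au.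
  by have := out_tree_ter_root a; rewrite au ru eqxx.
rewrite diwalk_rcons => /andP[pb /eqP bu].
have [bU | bNU] := boolP (ini b \in U); first exact: IHp pb.
exists u => // a; rewrite -bu => /out_tree_ter_inj ->; exact: bNU.
Qed.

(** A subgraph of a tree has fewer edges than vertices: edges inject into U by
their ends, and a top vertex of U is missed. *)
Lemma out_tree_card_induced (U : {set T}) :
  #|induced_edges U| <= #|U|.-1.
Proof.
have [-> | /out_tree_top[u0 u0U top]] := eqVneq U set0.
  rewrite cards0 leqn0 cards_eq0; apply/eqP/setP => a.
  by rewrite !inE.
rewrite -(card_imset _ out_tree_ter_inj) (cardsD1 u0 U) u0U /=.
apply/subset_leq_card/subsetP => _ /imsetP[a aU ->].
move: aU; rewrite !inE => /andP[iU ->]; rewrite andbT.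
by apply/eqP => au; move: iU; apply/negP/top.
Qed.

End OutTree.

(** * The constraints for quota trees and quota forests *)

Section QuotaTree.

Variables (G : multigraph) (r : G) (T : quota_tree r).

Let f := tree_map T.
Let treeT := @tree_out _ _ T.

Lemma tree_edge_bound e : #|efiber f e| <= #|vfiber f (ini e)|.
Proof.
have ini_inj : {in efiber f e &, injective (@ini T)}.
  move=> a b; rewrite !inE => /eqP ae /eqP be ab.
  apply: (@tree_immersion _ _ T (ini a)); rewrite ?inE ?ab //.
  by rewrite [LHS]ae.
rewrite -(card_in_imset ini_inj); apply/subset_leq_card/subsetP.
by move=> _ /imsetP[a + ->]; rewrite !inE -gmap_ini => /eqP->.
Qed.

Lemma tree_node_count v :
  \sum_(e | ter e == v) #|efiber f e| + (r == v) = #|vfiber f v|.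
Proof.
rewrite sum_card_fiber -(card_imset _ (out_tree_ter_inj treeT)).
rewrite (cardsD1 (tree_root T) (vfiber f v)) inE tree_map_root addnC.
congr (_ + _); apply: eq_card => u; rewrite !inE.
apply/imsetP/andP => [[a + ->] | [/(out_tree_terP treeT)[a <-] av]].
  by rewrite inE gmap_ter (out_tree_ter_root treeT).
by exists a => //; rewrite inE gmap_ter.
Qed.

Lemma tree_subset_bound (S : {set G}) :
  \sum_(e in induced_edges S) #|efiber f e| <= (\sum_(v in S) #|vfiber f v|).-1.
Proof.
rewrite !sum_card_fiber; apply: leq_trans (out_tree_card_induced treeT _).
by apply/eq_leq/eq_card => a; rewrite !inE gmap_ini gmap_ter.
Qed.

End QuotaTree.

Section QuotaForest.

Variables (G : multigraph) (s : G -> nat) (F : quota_forest s).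

Lemma forest_quotaE w :
  forest_quota F w =
  \sum_(j : tree_index s) #|vfiber (tree_map (component F j)) w|.
Proof. by rewrite /forest_quota sig_big_dep. Qed.

Lemma edge_inventoryE e :
  edge_inventory F e =
  \sum_(j : tree_index s) #|efiber (tree_map (component F j)) e|.
Proof.
under [RHS]eq_bigr do rewrite -sum1_card.
rewrite sig_big_dep /= /edge_inventory -sum1_card; apply: eq_bigl => a.
by rewrite !inE.
Qed.

Lemma forest_edge_bound e : edge_inventory F e <= forest_quota F (ini e).
Proof.
by rewrite edge_inventoryE forest_quotaE leq_sum // => j _; apply: tree_edge_bound.
Qed.

Lemma forest_node_count v :
  \sum_(e | ter e == v) edge_inventory F e + s v = forest_quota F v.
Proof.
have ->: s v = \sum_(j : tree_index s) (tag j == v).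
  rewrite -(@sig_big_dep _ _ _ _ (fun v => 'I_(s v)) xpredT (fun _ => xpredT)
    (fun u _ => nat_of_bool (u == v))) /=.
  rewrite (bigD1 v) //= [X in _ + X]big1 => [|u /negPf uv].
    by rewrite addn0 eqxx sum1_card card_ord.
  by rewrite uv big1.
under eq_bigr do rewrite edge_inventoryE.
rewrite exchange_big -big_split forest_quotaE; apply: eq_bigr => j _.
exact: tree_node_count.
Qed.

(** The bound of [tree_subset_bound] is strict only for components that meet the
preimage of S; one strict component is enough for the sum. *)
Lemma forest_subset_bound (S : {set G}) :
  0 < \sum_(v in S) forest_quota F v ->
  \sum_(e in induced_edges S) edge_inventory F e
    < \sum_(v in S) forest_quota F v.
Proof.
have ->: \sum_(v in S) forest_quota F v =
    \sum_j \sum_(v in S) #|vfiber (tree_map (component F j)) v|.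
  by rewrite [RHS]exchange_big; apply: eq_bigr => v _; rewrite forest_quotaE.
have ->: \sum_(e in induced_edges S) edge_inventory F e =
    \sum_j \sum_(e in induced_edges S) #|efiber (tree_map (component F j)) e|.
  by rewrite [RHS]exchange_big; apply: eq_bigr => e _; rewrite edge_inventoryE.
rewrite lt0n sum_nat_eq0.
case/forallPn => j; rewrite /= -lt0n => j_gt0.
rewrite (bigD1 j) //= [X in _ < X](bigD1 j) //= -addSn leq_add //.
  by rewrite -(ltn_predK j_gt0) ltnS tree_subset_bound.
apply: leq_sum => i _; apply: leq_trans (tree_subset_bound _ _) (leq_pred _).
Qed.

End QuotaForest.

(** * The tree of a prefix-closed set of words *)

(** A word lists the edges from a vertex of the tree up to the root, the most
recent edge first; [word_end] is where the walk that starts at v ends in G. *)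
Definition word_end (G : multigraph) (v : G) (w : seq (edge G)) : G :=
  if w is e :: _ then ter e else v.

Section WordTree.

Variables (G : multigraph) (v : G) (W : seq (seq (edge G))).
Hypothesis W_nil : [::] \in W.
Hypothesis W_cons : forall e w, e :: w \in W -> w \in W /\ word_end v w = ini e.

(** An edge is a pair of a label e and a node w whose child e :: w belongs to W;
both of its ends are then nodes by construction. *)
Definition word_graph : multigraph :=
  @Multigraph (seq_sub W) {a : edge G * seq_sub W | a.1 :: ssval a.2 \in W}
    (fun a => (val a).2) (fun a => SeqSub (valP a)).

Definition word_vmap (u : word_graph) : G := word_end v (ssval u).

Definition word_emap (a : edge word_graph) : edge G := (val a).1.

Fact word_map_ini a : ini (word_emap a) = word_vmap (ini a).
Proof. by have [_ vE] := W_cons (valP a); rewrite [RHS]vE. Qed.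

Fact word_map_ter a : ter (word_emap a) = word_vmap (ter a).
Proof. by []. Qed.

Definition word_map : gmap word_graph G := GMap word_map_ini word_map_ter.

Definition word_root : word_graph := SeqSub W_nil.

Lemma word_edge_inj (a b : edge word_graph) :
  ini a = ini b -> word_emap a = word_emap b -> a = b.
Proof.
move=> ab_ini ab_e; apply: val_inj.
by rewrite [LHS]surjective_pairing [RHS]surjective_pairing; congr (_, _).
Qed.

Lemma word_immersion : immersion word_map.
Proof.
by move=> u a b; rewrite !inE => /eqP <- /eqP /esym; apply: word_edge_inj.
Qed.

Lemma word_walkE (u0 u : word_graph) p :
  diwalk u0 u p -> ssval u = catrev (map word_emap p) (ssval u0).
Proof.
elim: p u0 => [|a p IHp] u0 /=; first by move/eqP->.
by case/andP=> /eqP <- /IHp.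
Qed.

(** Two walks with the same start and the same labels coincide since the map is an
immersion. *)
Lemma word_walk_inj (u0 u u' : word_graph) p p' :
  diwalk u0 u p -> diwalk u0 u' p' -> map word_emap p = map word_emap p' ->
  p = p'.
Proof.
elim: p p' u0 => [|a p IHp] [|a' p'] //= u0.
case/andP=> /eqP au pu /andP[/eqP au' pu'] [aa' pp'].
have Ea : a = a' := word_edge_inj (etrans au (esym au')) aa'.
by rewrite -Ea in pu' *; congr (_ :: _); apply: IHp pu pu' pp'.
Qed.

Lemma word_walk_exists (u : word_graph) : exists p, diwalk word_root u p.
Proof.
case: u => w; elim: w => [|e w IHw] W_w.
  by exists [::]; apply/eqP/val_inj.
have [W_w' _] := W_cons W_w; have [p pw] := IHw W_w'.
pose a : edge word_graph := Sub (e, SeqSub W_w') W_w.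
exists (rcons p a); rewrite diwalk_rcons pw.
by apply/eqP/val_inj.
Qed.

(** The labels of a walk from the root are dictated by the word at its end, and
they determine the walk. *)
Lemma word_out_tree : out_tree word_root.
Proof.
move=> u; have [p pu] := word_walk_exists u; exists p; split=> // p' pu'.
apply: (word_walk_inj pu pu'); apply: (can_inj revK).
have := word_walkE pu'; rewrite (word_walkE pu) !catrevE.
by rewrite !cats0.
Qed.

Definition word_tree : quota_tree v :=
  QuotaTree word_out_tree word_immersion (erefl : word_map word_root = v).

Hypothesis W_uniq : uniq W.

Lemma word_vfiber_card u :
  #|vfiber (tree_map word_tree) u| = count (fun w => word_end v w == u) W.
Proof.
rewrite cardE -(size_map val) -size_filter; apply/perm_size/uniq_perm.
- by rewrite map_inj_uniq ?enum_uniq //; apply: val_inj.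
- exact: filter_uniq.
move=> w; rewrite mem_filter; apply/mapP/andP.
  by case=> z; rewrite mem_enum inE => zu ->; split=> //; apply: valP.
by case=> wu W_w; exists (SeqSub W_w); rewrite // mem_enum inE.
Qed.

(** Here an edge is counted through the word at its end, whose first letter is
its label. *)
Lemma word_efiber_card e :
  #|efiber (tree_map word_tree) e| = count (fun w => ohead w == Some e) W.
Proof.
rewrite cardE -(size_map (fun a : edge word_graph => ssval (ter a))) -size_filter.
apply/perm_size/uniq_perm.
- rewrite map_inj_uniq ?enum_uniq // => a b.
  by case=> ab_e /val_inj ab_ini; apply: word_edge_inj.
- exact: filter_uniq.
move=> w; rewrite mem_filter; apply/mapP/andP.
  case=> a; rewrite mem_enum inE => /eqP ae ->; split; last exact: valP.
  by apply/eqP; congr Some.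
case; case: w => [|e' w] //= /eqP[->] W_w.
have [W_w' _] := W_cons W_w.
by exists (Sub (e, SeqSub W_w') W_w : edge word_graph); rewrite // mem_enum inE.
Qed.

End WordTree.

(** * Forests of words *)

Section WordForest.

Variables (G : multigraph) (s : G -> nat).

(** The tree in which the node lies, and its word in that tree. *)
Definition forest_node : Type := (tree_index s * seq (edge G))%type.

Definition node_end (z : forest_node) : G := word_end (tag z.1) z.2.

Definition child (z : forest_node) (e : edge G) : forest_node := (z.1, e :: z.2).

Definition word_forest (A : seq forest_node) : Prop :=
  [/\ uniq A, forall j, (j, [::]) \in A &
      forall z e, child z e \in A -> z \in A /\ node_end z = ini e].

Definition vcount (A : seq forest_node) (v : G) : nat :=
  count (fun z => node_end z == v) A.

Definition ecount (A : seq forest_node) (e : edge G) : nat :=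
  count (fun z => ohead z.2 == Some e) A.

Definition words_of (A : seq forest_node) (j : tree_index s) : seq (seq (edge G)) :=
  [seq z.2 | z <- A & z.1 == j].

Lemma mem_words_of A j w : (w \in words_of A j) = ((j, w) \in A).
Proof.
apply/mapP/idP => [[[i w'] + ->] | Ajw].
  by rewrite mem_filter => /andP[/eqP /= <-].
by exists (j, w); rewrite // mem_filter eqxx.
Qed.

Lemma words_of_uniq A j : uniq A -> uniq (words_of A j).
Proof.
move=> A_uniq; rewrite map_inj_in_uniq ?filter_uniq //.
move=> [i w] [i' w']; rewrite !mem_filter /=.
by move=> /andP[/eqP -> _] /andP[/eqP -> _] ->.
Qed.

Lemma sum_count_words A (P : tree_index s -> pred (seq (edge G))) :
  \sum_j count (P j) (words_of A j) = count (fun z => P z.1 z.2) A.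
Proof.
elim: A => [|z A IHA] /=; first by rewrite big1.
rewrite -IHA [in RHS](bigD1 z.1) //= addnA (bigD1 z.1) //=.
rewrite /words_of /= eqxx /=; congr (_ + _).
by apply: eq_bigr => j /negPf; rewrite eq_sym => ->.
Qed.

Section Realize.

Variable A : seq forest_node.
Hypothesis A_forest : word_forest A.

Lemma words_of_nil j : [::] \in words_of A j.
Proof. by rewrite mem_words_of; case: A_forest. Qed.

Lemma words_of_cons j e w :
  e :: w \in words_of A j ->
  w \in words_of A j /\ word_end (tag j) w = ini e.
Proof.
by rewrite !mem_words_of; have [_ _ A_child] := A_forest => /(A_child (j, w)).
Qed.

Definition realize : quota_forest s := fun v k =>
  word_tree (words_of_nil (Tagged _ k)) (@words_of_cons (Tagged _ k)).

Lemma realize_quota v : forest_quota realize v = vcount A v.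
Proof.
rewrite forest_quotaE.
apply: etrans (sum_count_words A (fun j w => word_end (tag j) w == v)).
apply: eq_bigr => -[u k] _; rewrite word_vfiber_card // words_of_uniq //.
by case: A_forest.
Qed.

Lemma realize_inventory e : edge_inventory realize e = ecount A e.
Proof.
rewrite edge_inventoryE.
apply: etrans (sum_count_words A (fun _ w => ohead w == Some e)).
apply: eq_bigr => -[u k] _; rewrite word_efiber_card // words_of_uniq //.
by case: A_forest.
Qed.

(** The node identity of the quota forest realized by A, read on the words. *)
Lemma vcountE v : vcount A v = \sum_(e | ter e == v) ecount A e + s v.
Proof.
rewrite -realize_quota -forest_node_count; congr (_ + _).
by apply: eq_bigr => e _; rewrite realize_inventory.
Qed.

End Realize.

Definition roots_only : seq forest_node := [seq (j, [::]) | j <- enum (tree_index s)].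

Lemma roots_only_forest : word_forest roots_only.
Proof.
split=> [|j|z e]; first by rewrite map_inj_uniq ?enum_uniq // => i j [].
  by apply: map_f; rewrite mem_enum.
by case/mapP.
Qed.

Lemma roots_only_ecount e : ecount roots_only e = 0.
Proof.
by rewrite /ecount count_map; apply/eqP; rewrite -leqn0 leqNgt -has_count; apply/hasPn.
Qed.

Lemma word_forest_add A z e :
  word_forest A -> z \in A -> node_end z = ini e -> child z e \notin A ->
  word_forest (child z e :: A).
Proof.
case=> A_uniq A_nil A_child Az ze ANze; split=> [|j|z' e'] /=.
- by rewrite ANze.
- by rewrite inE A_nil orbT.
rewrite !inE => /orP[/eqP[Ej -> Ew] | /A_child[-> ->]]; last by rewrite orbT.
by rewrite -ze [z']surjective_pairing Ej Ew -surjective_pairing Az orbT.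
Qed.

Lemma ecount_add A z e e' :
  ecount (child z e :: A) e' = (e == e') + ecount A e'.
Proof. by []. Qed.

(** * Greedy growth *)

Section Greedy.

Variables (q : G -> nat) (y : edge G -> nat).
Hypothesis y_edge : forall e, y e <= q (ini e).
Hypothesis y_node : forall v, \sum_(e | ter e == v) y e + s v = q v.
Hypothesis y_subset : forall S : {set G}, S != set0 ->
  \sum_(e in induced_edges S) y e < \sum_(v in S) q v.

Definition growable (A : seq forest_node) (e : edge G) : bool :=
  (ecount A e < y e) &&
  has (fun z => (node_end z == ini e) && (child z e \notin A)) A.

Lemma not_growable A e z :
  ~~ growable A e -> ecount A e < y e -> z \in A -> node_end z = ini e ->
  child z e \in A.
Proof.
rewrite /growable => + ye Az ze; rewrite ye /= => /hasPn/(_ z Az).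
by rewrite ze eqxx /= negbK.
Qed.

(** When e is deficient and cannot grow, taking the child along e injects the
nodes over its start into the nodes with last edge e. *)
Lemma not_growable_vcount A e :
  word_forest A -> ~~ growable A e -> ecount A e < y e ->
  vcount A (ini e) <= ecount A e.
Proof.
case=> A_uniq _ _ stuck ye; rewrite /vcount /ecount -!size_filter.
rewrite -(size_map (child^~ e)); apply: uniq_leq_size.
  by rewrite map_inj_uniq ?filter_uniq // => -[i w] [j w'] [-> ->].
move=> _ /mapP[z + ->]; rewrite !mem_filter => /andP[/eqP ze Az].
by rewrite eqxx (not_growable stuck).
Qed.

Lemma vcount0_growable A :
  word_forest A -> [set v | vcount A v == 0] != set0 -> exists e, growable A e.
Proof.
move=> A_forest; set Z := [set _ | _] => Z_n0.
have Z0 v : v \in Z -> s v = 0 /\ forall e, ter e = v -> ecount A e = 0.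
  rewrite inE vcountE // addn_eq0 sum_nat_eq0 => /andP[/forallP A0 /eqP sv].
  by split=> // e ev; apply/eqP; have := A0 e; rewrite ev eqxx.
(* Otherwise every edge counted by y into Z stays inside Z, so the edges inside Z
   account for all of q over Z. *)
have [e /and3P[eZ eNZ ye]] : exists e, [&& ter e \in Z, ini e \notin Z & 0 < y e].
  apply/existsP; apply: contraLR (y_subset Z_n0); rewrite negb_exists -leqNgt.
  move=> /forallP y0.
  have ->: \sum_(v in Z) q v = \sum_(e | ter e \in Z) y e.
    rewrite [RHS](partition_big (@ter G) (mem Z)) //=; apply: eq_bigr => v vZ.
    rewrite -y_node; have [-> _] := Z0 v vZ; rewrite addn0.
    by apply: eq_bigl => e; case: eqP => [->|]; rewrite ?vZ ?andbF.
  rewrite (bigID (fun e => ini e \in Z)) /= [X in _ + X]big1 => [|e].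
    by rewrite addn0 leq_eqVlt; apply/orP; left; apply/eqP/eq_bigl => e; rewrite [RHS]inE andbC.
  by case/andP=> eZ eNZ; have := y0 e; rewrite eZ eNZ -eqn0Ngt => /eqP.
exists e; apply/contraT => stuck; have [_ /(_ e erefl) e0] := Z0 _ eZ.
have := not_growable_vcount A_forest stuck; rewrite e0 leqn0 => /(_ ye).
by move: eNZ; rewrite inE => /negPf->.
Qed.

Definition depth (A : seq forest_node) (v : G) : nat :=
  \max_(z <- A | node_end z == v) size z.2.

(** Every node over ini e has a child along e, one level deeper, over ter e. *)
Lemma depth_ter A e :
  ~~ growable A e -> ecount A e < y e -> 0 < vcount A (ini e) ->
  depth A (ini e) < depth A (ter e).
Proof.
move=> stuck ye; rewrite -has_count => /hasP[z0 Az0 /eqP z0e].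
have deeper z : z \in A -> node_end z = ini e -> size z.2 < depth A (ter e).
  move=> Az /(not_growable stuck ye Az) Aze.
  exact: (leq_bigmax_seq (child z e)).
rewrite -(ltn_predK (deeper z0 Az0 z0e)) ltnS.
apply/bigmax_leqP_seq => z Az /eqP/(deeper z Az).
by rewrite -ltnS; case: (depth A (ter e)).
Qed.

Lemma exists_growable A e :
  word_forest A -> ecount A e < y e -> (forall e, ecount A e <= y e) ->
  exists e, growable A e.
Proof.
move=> A_forest ye A_le.
have [Z0 | ] := eqVneq [set v | vcount A v == 0] set0; last first.
  exact: vcount0_growable.
have v_gt0 v : 0 < vcount A v.
  by rewrite lt0n; apply/negP => v0; have := in_set0 v; rewrite -Z0 inE v0.
apply/existsP; apply: contraT; rewrite negb_exists => /forallP stuck.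
case: (@arg_minnP _ e (fun e => ecount A e < y e) (fun e => depth A (ter e)) ye).
move=> {ye} {}e ye e_min.
(* The start of e is short of its quota, hence so is some edge into it. *)
have [e1 /andP[/eqP e1e ye1]] : exists e1, (ter e1 == ini e) && (ecount A e1 < y e1).
  apply/existsP; apply: contraT; rewrite negb_exists => /forallP y_le.
  have : q (ini e) <= vcount A (ini e).
    rewrite vcountE // -y_node leq_add2r; apply: leq_sum => e1 e1e.
    by have := y_le e1; rewrite e1e /= -leqNgt.
  have := not_growable_vcount A_forest (stuck e) ye; have := y_edge e; lia.
have := e_min _ ye1; rewrite e1e leqNgt.
by rewrite depth_ter.
Qed.

(** By induction on the number of edges that are still missing. *)
Lemma complete_forest : exists2 A, word_forest A & forall e, ecount A e = y e.
Proof.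
suff grow n A : word_forest A -> (forall e, ecount A e <= y e) ->
    \sum_e (y e - ecount A e) = n ->
    exists2 A, word_forest A & forall e, ecount A e = y e.
  apply: grow roots_only_forest _ erefl => e.
  by rewrite roots_only_ecount.
elim: n A => [|n IHn] A A_forest A_le.
  move/eqP; rewrite sum_nat_eq0 => /forallP A_eq; exists A => // e.
  by apply/eqP; rewrite eqn_leq A_le -subn_eq0; apply: A_eq.
move=> An; have [e0 ye0] : exists e0, ecount A e0 < y e0.
  apply/existsP; apply: contraT; rewrite negb_exists => /forallP y_le.
  move: An; rewrite big1 // => e _; apply/eqP.
  by rewrite subn_eq0 leqNgt.
have [e /andP[ye /hasP[z Az /andP[/eqP ze ANze]]]] :=
  exists_growable A_forest ye0 A_le.
apply: (IHn (child z e :: A)); first exact: word_forest_add.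
  by move=> e'; rewrite ecount_add; case: eqP => [<-|_]; [exact: ye | exact: A_le].
apply: succn_inj; rewrite -An (bigD1 e) // [in RHS](bigD1 e) //.
rewrite ecount_add eqxx -addSn -subSn // subSS; congr (_ + _).
by apply: eq_bigr => e' /negPf e'e; rewrite ecount_add eq_sym e'e.
Qed.

End Greedy.

End WordForest.

Local Open Scope ring_scope.

Theorem theorem14 (G : multigraph) (q s : G -> nat)
    (q_gt0 : forall v : G, (0 < q v)%N) :
  (forall F : quota_forest s, achieves F q ->
     let x := fun e : edge G => (edge_inventory F e)%:Z in
     [/\ edge_constraint q x, node_constraint q s x & subset_constraint q x])
  /\
  (achievable q s ->
   forall x : edge G -> int,
     edge_constraint q x -> node_constraint q s x -> subset_constraint q x ->
     exists F : quota_forest s,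
       achieves F q /\ forall e : edge G, (edge_inventory F e)%:Z = x e).
Proof.
have PoszE (I : finType) (P : pred I) (m : I -> nat) :
    \sum_(i | P i) (m i)%:Z = (\sum_(i | P i) m i)%N%:Z.
  by rewrite (big_morph Posz PoszD erefl).
split=> [F Fq /= | _ x x_edge x_node x_subset].
  split=> [e | v | S S_gt0].
  - by have := forest_edge_bound F e; rewrite Fq; lia.
  - by rewrite PoszE -Fq -forest_node_count; lia.
  have [v vS] : exists v, v \in S by apply/set0Pn; rewrite -card_gt0.
  have := @forest_subset_bound _ _ F S; rewrite !PoszE.
  under eq_bigr do rewrite Fq.
  have : (0 < \sum_(v in S) q v)%N.
    by rewrite (bigD1 v) //= addn_gt0 q_gt0.
  by move=> -> /(_ isT); lia.
pose y e := absz (x e).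
have yE e : x e = (y e)%:Z by rewrite gez0_abs //; case/andP: (x_edge e).
have y_edge e : (y e <= q (ini e))%N.
  by have := x_edge e; rewrite yE => /andP[].
have y_node v : (\sum_(e | ter e == v) y e + s v)%N = q v.
  have := x_node v; rewrite (eq_bigr _ (fun e _ => yE e)).
  by rewrite PoszE; lia.
have y_subset (S : {set G}) : S != set0 ->
    (\sum_(e in induced_edges S) y e < \sum_(v in S) q v)%N.
  rewrite -card_gt0 => /x_subset; rewrite (eq_bigr _ (fun e _ => yE e)).
  by rewrite !PoszE; lia.
have [A A_forest Ay] := complete_forest y_edge y_node y_subset.
exists (realize A_forest); split=> [v | e].
  rewrite realize_quota vcountE // -y_node.
  by congr (_ + _)%N; apply: eq_bigr => e _; rewrite Ay.
by rewrite realize_inventory Ay yE.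
Qed.
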